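(* Let $A\subseteq\omega$ be an infinite c.e. set and, for every $n\ge1$, let $\theta^{(n)}$ be a quasi-Gödel numbering of $\mathcal S^{(n)}_A$. Then for all $m,n\ge1$ there is a function $\mathrm{sub}\in\mathcal R^{(m+1)}$ such that for all $j,j_1,\dots,j_m\in\omega$, $$\theta^{(n)}_{\mathrm{sub}(j,j_1,\dots,j_m)}=\mathrm{MSubst}^{(m,n)}_A\big(\theta^{(m)}_j;\theta^{(n)}_{j_1},\dots,\theta^{(n)}_{j_m}\big).$$
   Context: $\omega$ is the set of natural numbers; $\mathcal R^{(n)}$ is the set of total computable functions $\omega^n\to\omega$. $\langle\cdot,\cdot\rangle:\omega^2\to\omega$ is a computable bijection with $\langle x,y\rangle\ge x,y$, extended by $\langle x\rangle=x$, $\langle x_1,\dots,x_{n+1}\rangle=\langle x_1,\langle x_2,\dots,x_{n+1}\rangle\rangle$. $\mathrm{Anf}^{(n)}_A$ is the set of partial functions from $\omega^n$ to $\omega$ whose domain is either empty or equal to $\{0,\dots,a-1\}^n$ for some $a\in A$, and $\mathcal S^{(n)}_A=\mathcal R^{(n)}\cup\mathrm{Anf}^{(n)}_A$. The extended graph of an $n$-ary partial function $q$ is $\{\langle\langle\vec y\rangle,0\rangle:\vec y\in\omega^n\}\cup\{\langle\langle\vec x\rangle,q(\vec x)+1\rangle:\vec x\in\mathrm{dom}(q)\}$. A numbering of a set $X$ is a surjection $\omega\to X$. A numbering $\theta$ of $\mathcal S^{(n)}_A$ is a quasi-Gödel numbering if: (QGN I) the extended graph of $(i,\vec x)\mapsto\theta_i(\vec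 x)$ is the range of a function in $\mathcal R^{(1)}$; and (QGN II) for every $k\in\mathcal R^{(2)}$ there is $v\in\mathcal R^{(1)}$ such that for all $i\in\omega$, $r\in\mathcal S^{(n)}_A$: if $\{k(i,t):t\in\omega\}$ is the extended graph of $r$, then $r=\theta_{v(i)}$. Modified substitution: for an $n$-ary partial function $q$ on $\omega$, $\widehat M^{(n)}_A(q)$ is the restriction of $q$ to the set of those $\vec x\in\omega^n$ for which there is $a\in A$ with $\vec x\in\{0,\dots,a-1\}^n\subseteq\mathrm{dom}(q)$ (undefined elsewhere). $\mathrm{Subst}^{(m,n)}(r;p_1,\dots,p_m)$ is the usual composition $\vec x\mapsto r(p_1(\vec x),\dots,p_m(\vec x))$ of an $m$-ary partial function $r$ with $n$-ary partial functions $p_1,\dots,p_m$ (defined at $\vec x$ iff all $p_\nu(\vec x)$ are defined and $r$ is defined at the resulting tuple). $\mathrm{MSubst}^{(m,n)}_A=\widehat M^{(n)}_A\circ\mathrm{Subst}^{(m,n)}$. *)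

(* Defs.v *)
From mathcomp Require Import all_boot.
From mathcomp Require Import boolp classical_sets functions cardinality.

Set Implicit Arguments.
Unset Strict Implicit.
Unset Printing Implicit Defensive.

Local Open Scope classical_set_scope.

(* Algorithms for the n-ary partial (mu-)recursive functions. *)
Inductive mu_rec : nat -> Type :=
| Zero n : mu_rec n
| Succ : mu_rec 1
| Proj n (i : 'I_n) : mu_rec n
| Comp m n (f : mu_rec m) (g : 'I_m -> mu_rec n) : mu_rec n
| Prec n (f : mu_rec n) (g : mu_rec n.+2) : mu_rec n.+1
| Mu n (f : mu_rec n.+1) : mu_rec n.

(* Graph of primitive recursion on k, from the graphs F (base) and G (step);
   the step takes the predecessor of k and the previous value first. *)
Fixpoint prec_rel n (F : n.-tuple nat -> nat -> Prop)
    (G : n.+2.-tuple nat -> nat -> Prop) (x : n.-tuple nat) (k : nat) :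
    nat -> Prop :=
  if k is k'.+1 then
    fun y => exists2 z, prec_rel F G x k' z & G [tuple of k' :: z :: x] y
  else F x.

(* [eval e x y]: algorithm e halts on input x with output y.  [Prec] recurses
   on the first argument; [Mu] minimises over the first argument and requires
   all earlier values to be defined. *)
Fixpoint eval n (e : mu_rec n) : n.-tuple nat -> nat -> Prop :=
  match e with
  | Zero n => fun _ y => y = 0
  | Succ => fun x y => y = (thead x).+1
  | Proj n i => fun x y => y = tnth x i
  | Comp m n f g => fun x y =>
      exists2 z : m.-tuple nat, (forall i, eval (g i) x (tnth z i)) & eval f z y
  | Prec n f g => fun x =>
      prec_rel (eval f) (eval g) [tuple of behead x] (thead x)
  | Mu n f => fun x y =>
      eval f [tuple of y :: x] 0 /\
      (forall k, k < y -> exists z, eval f [tuple of k :: x] z.+1)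
  end.

(* R^(n) *)
Definition computable n : set (n.-tuple nat -> nat) :=
  [set f | exists e : mu_rec n, forall x, eval e x (f x)].

Definition ce (A : set nat) : Prop :=
  A = set0 \/ exists2 f : 1.-tuple nat -> nat, computable f & A = range f.

Definition pairing (pr : 2.-tuple nat -> nat) : Prop :=
  [/\ computable pr, bijective pr &
      forall x y, x <= pr [tuple x; y] /\ y <= pr [tuple x; y]].

(* The value at [::] is junk: only tuples of positive length are coded. *)
Fixpoint code (pr : 2.-tuple nat -> nat) (s : seq nat) : nat :=
  match s with
  | [::] => 0
  | [:: x] => x
  | x :: s' => pr [tuple x; code pr s']
  end.

(* Partial functions from omega^n to omega; [None] means undefined. *)
Definition pfun n := n.-tuple nat -> option nat.

Definition dom n (q : pfun n) : set (n.-tuple nat) := [set x | q x].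

Definition total n (f : n.-tuple nat -> nat) : pfun n := fun x => Some (f x).

(* {0, ..., a-1}^n *)
Definition box n (a : nat) : set (n.-tuple nat) :=
  [set x | forall i, tnth x i < a].
Arguments box : clear implicits.

Definition Anf (A : set nat) n : set (pfun n) :=
  [set q | dom q = set0 \/ exists2 a, A a & dom q = box n a].
Arguments Anf : clear implicits.

(* S_A^(n) *)
Definition SA (A : set nat) n : set (pfun n) :=
  [set total f | f in @computable n] `|` Anf A n.
Arguments SA : clear implicits.

Definition extgraph (pr : 2.-tuple nat -> nat) n (q : pfun n) : set nat :=
  [set pr [tuple code pr y; 0] | y in [set: n.-tuple nat]] `|`
  [set z | exists x v, q x = Some v /\ z = pr [tuple code pr x; v.+1]].

(* (i, x) |-> theta_i(x) *)
Definition universal n (theta : nat -> pfun n) : pfun n.+1 :=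
  fun z => theta (thead z) [tuple of behead z].

Definition numbering T (X : set T) (theta : nat -> T) : Prop :=
  range theta = X.

Definition QGN1 pr n (theta : nat -> pfun n) : Prop :=
  exists2 f : 1.-tuple nat -> nat,
    computable f & range f = extgraph pr (universal theta).

Definition QGN2 pr A n (theta : nat -> pfun n) : Prop :=
  forall k : 2.-tuple nat -> nat, computable k ->
  exists2 v : 1.-tuple nat -> nat, computable v &
    forall i (r : pfun n), SA A n r ->
      [set k [tuple i; t] | t in [set: nat]] = extgraph pr r ->
      r = theta (v [tuple i]).

Definition quasi_godel pr A n (theta : nat -> pfun n) : Prop :=
  [/\ numbering (SA A n) theta, QGN1 pr theta & QGN2 pr A theta].

Definition Mhat (A : set nat) n (q : pfun n) : pfun n := fun x =>
  if `[< exists a, [/\ A a, box n a x & box n a `<=` dom q] >]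
  then q x else None.

(* The default 0 is never used: all the [p nu x] are defined in that branch. *)
Definition Subst m n (r : pfun m) (p : 'I_m -> pfun n) : pfun n := fun x =>
  if [forall nu, p nu x] then r [tuple odflt 0 (p nu x) | nu < m] else None.

Definition MSubst (A : set nat) m n (r : pfun m) (p : 'I_m -> pfun n) : pfun n :=
  Mhat A (Subst r p).

(* Main.v *)
(* The graph of MSubst(theta_j; theta_j1, ..., theta_jm) is semidecidable
   uniformly in j, j1, ..., jm: the graphs of the universal functions are c.e.
   by QGN I, A is c.e., and "{0, ..., a-1}^n is contained in the domain" is a
   bounded universal quantifier over a semidecidable condition. Hence one k in
   R^(2) enumerates all the extended graphs, with i coding (j, j1, ..., jm),
   and QGN II turns k into sub. QGN II applies because MSubst stays in S_A: if
   it is total, its semidecidable graph makes it computable; otherwise the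
   boxes with side in A inside the domain have bounded sides, so there are none
   or a largest one is the domain. *)
Require Import Defs.
From mathcomp Require Import all_boot.
From mathcomp Require Import boolp classical_sets functions cardinality.

Set Implicit Arguments.
Unset Strict Implicit.
Unset Printing Implicit Defensive.

(** * Computable functions on sequences of fixed length *)

Lemma computable_comp m n (f : m.-tuple nat -> nat)
    (X : n.-tuple nat -> m.-tuple nat) :
  computable f -> (forall i, computable (fun x => tnth (X x) i)) ->
  computable (fun x => f (X x)).
Proof.
move=> [e he] /choice[g hg]; exists (Comp e g) => x /=.
by exists (X x) => // i; apply: hg.
Qed.

(* Only the values of [F] on sequences of size [n] matter. *)
Definition recf n (F : seq nat -> nat) : Prop :=
  computable (fun x : n.-tuple nat => F x).

(** Sequences take the place of tuples so that [take], [drop] and [behead] compose without casts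
    between lengths; the size condition does the work of the tuple type. The index [i] may run past
    [n], where [nth] returns 0. *)
Definition vecf d n (X : seq nat -> seq nat) : Prop :=
  (forall s, size s = d -> size (X s) = n) /\
  (forall i, recf d (fun s => nth 0 (X s) i)).

(** Classically every proposition has a truth value [asbool]; the content is that this 0/1 function
    is computable. *)
Definition dec n (P : seq nat -> Prop) : Prop :=
  recf n (fun s => nat_of_bool `[< P s >]).

Lemma recf_ext n F G :
  (forall s, size s = n -> F s = G s) -> recf n F -> recf n G.
Proof.
by move=> FG [e he]; exists e => x; rewrite -FG ?size_tuple //; apply: he.
Qed.

Lemma recf_nth n i : recf n (fun s => nth 0 s i).
Proof.
have [lt_in|le_ni] := ltnP i n.
  by exists (Proj (Ordinal lt_in)) => x /=; rewrite (tnth_nth 0).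
by exists (Zero n) => x /=; rewrite nth_default // size_tuple.
Qed.

Lemma recf_app m d (f : m.-tuple nat -> nat) (X : seq nat -> m.-tuple nat) :
  computable f -> (forall i, recf d (fun s => tnth (X s) i)) ->
  recf d (fun s => f (X s)).
Proof. by move=> hf hX; apply: (computable_comp hf). Qed.

Lemma recf_app1 d (f : 1.-tuple nat -> nat) F :
  computable f -> recf d F -> recf d (fun s => f [tuple F s]).
Proof.
move=> hf hF; apply: recf_app => // i.
by apply: recf_ext hF => s _; rewrite (tnth_nth 0) ord1.
Qed.

Lemma recf_app2 d (f : 2.-tuple nat -> nat) F G :
  computable f -> recf d F -> recf d G -> recf d (fun s => f [tuple F s; G s]).
Proof.
move=> hf hF hG; apply: recf_app => // -[[|[|//]] lti].
  by apply: recf_ext hF => s _; rewrite (tnth_nth 0).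
by apply: recf_ext hG => s _; rewrite (tnth_nth 0).
Qed.

Lemma recf_sub m d F X : recf m F -> vecf d m X -> recf d (fun s => F (X s)).
Proof.
move=> hF [sX hX].
have sz (x : d.-tuple nat) : size (X x) == m by rewrite sX ?size_tuple.
apply: (computable_comp (X := fun x => Tuple (sz x)) hF) => i.
by case: (hX i) => e he; exists e => x; rewrite (tnth_nth 0); apply: he.
Qed.

Lemma vecf_cons d n F X :
  recf d F -> vecf d n X -> vecf d n.+1 (fun s => F s :: X s).
Proof. by move=> hF [sX hX]; split=> [s /sX /= ->|[|i]] //=; apply: hX. Qed.

Lemma vecf_drop n d : vecf (n + d) d (drop n).
Proof.
split=> [s|i]; first by rewrite size_drop => ->; rewrite addKn.
by apply: recf_ext (recf_nth _ (n + i)) => s _; rewrite nth_drop.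
Qed.

Lemma vecf_behead d : vecf d.+1 d behead.
Proof.
split=> [s|i]; first by rewrite size_behead => ->.
by apply: recf_ext (recf_nth _ i.+1) => s _; rewrite nth_behead.
Qed.

Lemma vecf_take n d : vecf (n + d) n (take n).
Proof.
split=> [s hs|i]; first by rewrite size_takel // hs leq_addr.
have [lt_in|le_ni] := ltnP i n.
  by apply: recf_ext (recf_nth _ i) => s _; rewrite nth_take.
apply: recf_ext (recf_nth _ (n + d)) => s hs.
by rewrite !nth_default ?hs // size_take_min geq_min le_ni.
Qed.

Lemma vecf_id d : vecf d d id.
Proof. by split=> // i; apply: recf_nth. Qed.

Lemma vecf_sub d e n X Y :
  vecf e n X -> vecf d e Y -> vecf d n (fun s => X (Y s)).
Proof.
move=> [sX hX] hY; split=> [s hs|i]; first by apply/sX/(proj1 hY).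
exact: (recf_sub (hX i) hY).
Qed.

(** A quantified variable is put at the front of the sequence, while [semi] expects the stage there;
    this exchanges the two. *)
Lemma vecf_swap d : vecf d.+2 d.+2
  (fun s => nth 0 (behead s) 0 :: nth 0 s 0 :: behead (behead s)).
Proof.
apply: vecf_cons; first exact: (vecf_behead _).2.
apply: vecf_cons; first exact: recf_nth.
exact: vecf_sub (vecf_behead _) (vecf_behead _).
Qed.

Lemma recf_succ d F : recf d F -> recf d (fun s => (F s).+1).
Proof.
move=> hF; apply: (@recf_app1 d (fun x => (thead x).+1) F) => //.
by exists Succ.
Qed.

Lemma recf_const d c : recf d (fun=> c).
Proof. by elim: c => [|c]; [exists (Zero d) | apply: recf_succ]. Qed.

Lemma vecf_nil d : vecf d 0 (fun=> [::]).
Proof.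
by split=> // i; apply: recf_ext (recf_const d 0) => s _; rewrite nth_nil.
Qed.

Lemma vecf_const d (t : seq nat) : vecf d (size t) (fun=> t).
Proof. by split=> // i; apply: recf_const. Qed.

(** * Primitive recursion, decidable predicates and minimisation *)

Fixpoint primrec (F G : seq nat -> nat) s k : nat :=
  if k is k'.+1 then G [:: k', primrec F G s k' & s] else F s.

Lemma recf_primrec d F G K : recf d F -> recf d.+2 G -> recf d K ->
  recf d (fun s => primrec F G s (K s)).
Proof.
move=> [e he] [g hg] hK.
have h : recf d.+1 (fun s => primrec F G (behead s) (nth 0 s 0)).
  exists (Prec e g) => x /=.
  rewrite -(tnth_nth 0 x ord0) -/(thead x).
  elim: (thead x) => [|k IH] /=; first exact: he.
  by exists (primrec F G (behead x) k) => //; apply: hg.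
exact: (recf_sub h (vecf_cons hK (vecf_id d))).
Qed.

(** The truth value of [P] serves as the number of recursion steps: zero steps give the base [G],
    one step gives [F], which ignores the counter and the previous value. *)
Lemma recf_if d (P : seq nat -> Prop) F G : dec d P -> recf d F -> recf d G ->
  recf d (fun s => if `[< P s >] then F s else G s).
Proof.
rewrite /dec => hP hF hG.
have hF2 : recf d.+2 (fun s => F (behead (behead s))).
  exact: (recf_sub hF (vecf_sub (vecf_behead _) (vecf_behead _))).
by apply: recf_ext (recf_primrec hG hF2 hP) => s _; case: asboolP.
Qed.

Lemma dec_ext d (P Q : seq nat -> Prop) :
  (forall s, size s = d -> P s <-> Q s) -> dec d P -> dec d Q.
Proof.
by move=> PQ; apply: recf_ext => s /PQ; rewrite -propeqE => ->.
Qed.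

Lemma dec_sub m d P X : dec m P -> vecf d m X -> dec d (fun s => P (X s)).
Proof. exact: recf_sub. Qed.

Lemma dec_not d P : dec d P -> dec d (fun s => ~ P s).
Proof.
move=> hP; apply: recf_ext (recf_if hP (recf_const d 0) (recf_const d 1)) => s _.
by rewrite asbool_neg; case: asboolP.
Qed.

Lemma dec_and d P Q : dec d P -> dec d Q -> dec d (fun s => P s /\ Q s).
Proof.
move=> hP hQ; apply: recf_ext (recf_if hP hQ (recf_const d 0)) => s _.
by rewrite asbool_and; case: asboolP.
Qed.

(** Truncated subtraction iterates the predecessor, and the predecessor is the recursion whose step
    returns its counter. *)
Lemma recf_subn d F G : recf d F -> recf d G -> recf d (fun s => F s - G s).
Proof.
have hpred n H : recf n H -> recf n (fun s => (H s).-1).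
  move=> hH; apply: recf_ext (recf_primrec (recf_const _ 0) (recf_nth _ 0) hH).
  by move=> s _; case: (H s).
move=> hF hG; apply: recf_ext (recf_primrec hF (hpred _ _ (recf_nth _ 1)) hG).
by move=> s _; elim: (G s) => [|k /= ->]; rewrite ?subn0 ?subnS.
Qed.

Lemma dec_neq0 d F : recf d F -> dec d (fun s => F s <> 0).
Proof.
move=> hF.
apply: recf_ext (recf_primrec (recf_const _ 0) (recf_const _ 1) hF) => s _.
by case: (F s) => [|k] /=; [rewrite asboolF //; apply | rewrite asboolT].
Qed.

Lemma dec_eq d F G : recf d F -> recf d G -> dec d (fun s => F s = G s).
Proof.
move=> hF hG.
apply: dec_ext (dec_and (dec_not (dec_neq0 (recf_subn hF hG)))
                        (dec_not (dec_neq0 (recf_subn hG hF)))) => s _.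
split=> [[/contrapT/eqP FG /contrapT/eqP GF]|->]; last first.
  by rewrite subnn; split; apply.
by apply/eqP; rewrite eqn_leq -!subn_eq0 FG GF.
Qed.

Lemma dec_lt d F G : recf d F -> recf d G -> dec d (fun s => F s < G s).
Proof.
move=> hF hG; apply: dec_ext (dec_neq0 (recf_subn hG hF)) => s _.
by rewrite -subn_gt0 lt0n; split=> /eqP.
Qed.

(** Recursion on the bound, accumulating the truth value of the conjunction so far: entry 0 of the
    step's argument is the counter, entry 1 the accumulated value. *)
Lemma dec_ball d (P : nat -> seq nat -> Prop) b :
  dec d.+1 (fun s => P (nth 0 s 0) (behead s)) -> recf d b ->
  dec d (fun s => forall k, k < b s -> P k s).
Proof.
move=> hP hb.
have hG : recf d.+2 (fun s => if `[< nth 0 s 1 <> 0 >]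
    then nat_of_bool `[< P (nth 0 s 0) (behead (behead s)) >] else 0).
  apply: recf_if (dec_neq0 (recf_nth _ 1)) _ (recf_const _ 0).
  apply: (dec_sub hP (X := fun s => nth 0 s 0 :: behead (behead s))).
  apply: vecf_cons (recf_nth _ 0) _.
  exact: vecf_sub (vecf_behead _) (vecf_behead _).
apply: recf_ext (recf_primrec (recf_const _ 1) hG hb) => s _.
elim: (b s) => [|k IH] /=; first by case: asboolP => // -[].
rewrite {}IH; case: asboolP => /= [|/contrapT].
  case: asboolP => // ltP _; congr nat_of_bool; apply: asbool_equiv_eq.
  split=> [Pk j|]; last exact.
  by rewrite ltnS leq_eqVlt => /orP[/eqP->//|]; apply: ltP.
case: asboolP => // nP _; case: asboolP => // h; case: nP => j jk.
by apply: h; apply: ltnW.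
Qed.

Lemma dec_bex d (P : nat -> seq nat -> Prop) b :
  dec d.+1 (fun s => P (nth 0 s 0) (behead s)) -> recf d b ->
  dec d (fun s => exists2 k, k < b s & P k s).
Proof.
move=> hP hb.
apply: dec_ext (dec_not (dec_ball (P := fun k s => ~ P k s) (dec_not hP) hb)).
move=> s _; split=> [|[k kb Pk] /(_ k kb)//].
by move=> h; apply: contrapT => nP; apply: h => k kb Pk; apply: nP; exists k.
Qed.

(** [G] returns the least witness. Since [Mu] looks for a zero, it is applied to the characteristic
    function of the negation of [P]. *)
Lemma recf_mu d (P : nat -> seq nat -> Prop) :
  dec d.+1 (fun s => P (nth 0 s 0) (behead s)) ->
  (forall s, size s = d -> exists y, P y s) ->
  exists2 G, recf d G & forall s, size s = d -> P (G s) s.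
Proof.
move=> hP exP.
have /choice[G hG] s : exists y, size s = d ->
    P y s /\ forall k, k < y -> ~ P k s.
  have [hs|] := pselect (size s = d); last by exists 0.
  have ex : exists y, `[< P y s >].
    by have [y Py] := exP _ hs; exists y; apply/asboolP.
  exists (ex_minn ex) => _; case: ex_minnP => y /asboolP Py miny.
  by split=> // k ky /asboolP/miny; rewrite leqNgt ky.
exists G => [|s /hG[]//].
have [e he] := dec_not hP.
exists (Mu e) => x /=; have [PG minG] := hG x (size_tuple x); split=> [|k kG].
  by have := he [tuple of G x :: x]; rewrite /= asbool_neg; case: asboolP.
(* Below the least witness the negation of [P] has value 1, the successor of 0. *)
exists 0; have := he [tuple of k :: x]; rewrite /= asbool_neg.
by case: asboolP => // /minG -/(_ kG).
Qed.

(* Semidecidability. Monotonicity in the bound [B] on the witnesses makes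
   bounded universal quantification possible without coding sequences. *)
Definition semi d (P : seq nat -> Prop) : Prop :=
  exists R : nat -> seq nat -> Prop,
    [/\ dec d.+1 (fun s => R (nth 0 s 0) (behead s)),
        forall s B B', B <= B' -> R B s -> R B' s &
        forall s, size s = d -> P s <-> exists B, R B s].

Lemma semi_ext d (P Q : seq nat -> Prop) :
  (forall s, size s = d -> P s <-> Q s) -> semi d P -> semi d Q.
Proof.
move=> PQ [R [decR monoR RP]]; exists R; split=> // s hs.
by rewrite -PQ //; apply: RP.
Qed.

Lemma semi_dec d P : dec d P -> semi d P.
Proof.
move=> hP; exists (fun=> P); split=> //; last first.
  by move=> s _; split=> [|[]//]; exists 0.
exact: dec_sub hP (vecf_behead d).
Qed.

(** By monotonicity the larger of the two stages works for both conjuncts. *)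
Lemma semi_and d P Q : semi d P -> semi d Q -> semi d (fun s => P s /\ Q s).
Proof.
move=> [R [dR mR RP]] [S [dS mS SQ]]; exists (fun B s => R B s /\ S B s); split.
- exact: dec_and.
- by move=> s B B' BB' [/(mR _ _ _ BB') ? /(mS _ _ _ BB') ?].
move=> s hs; rewrite RP // SQ //; split=> [[[B RB] [C SC]]|[B [RB SB]]].
  exists (maxn B C); split; first by apply: mR RB; apply: leq_maxl.
  by apply: mS SC; apply: leq_maxr.
by split; exists B.
Qed.

Lemma semi_forall d m (P : 'I_m -> seq nat -> Prop) :
  (forall i, semi d (P i)) -> semi d (fun s => forall i, P i s).
Proof.
move=> hP; have : semi d (fun s => forall i, i \in enum 'I_m -> P i s).
  elim: (enum _) => [|j l IH].
    apply: semi_ext (semi_dec (dec_eq (recf_const d 0) (recf_const d 0))) => s _.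
    by split.
  apply: semi_ext (semi_and (hP j) IH) => s _; split=> [[Pj Pl] i|Pjl].
    by rewrite inE => /orP[/eqP->|/Pl].
  by split=> [|i il]; apply: Pjl; rewrite inE ?eqxx ?il ?orbT.
apply: semi_ext => s _; split=> Ps i //; apply: Ps; exact: mem_enum.
Qed.

(** One number [B] bounds both the witness [k] and the stage at which [k] is accepted, which keeps
    the new relation monotone and decidable. *)
Lemma semi_ex d (P : nat -> seq nat -> Prop) :
  semi d.+1 (fun s => P (nth 0 s 0) (behead s)) ->
  semi d (fun s => exists k, P k s).
Proof.
move=> [R [dR mR RP]].
exists (fun B s => exists2 k, k < B.+1 & R B (k :: s)); split.
- apply: (dec_bex (P := fun k s => R (nth 0 s 0) (k :: behead s)));
    last exact: recf_succ (recf_nth _ 0).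
  exact: dec_sub dR (vecf_swap d).
- move=> s B B' BB' [k kB RB]; exists k; first by apply: leq_trans kB _.
  exact: mR RB.
move=> s hs; split=> [[k /(RP (k :: s))]|[B [k _ RB]]].
  rewrite /= hs => /(_ erefl)[B RB]; exists (maxn B k), k.
    by rewrite ltnS leq_maxr.
  by apply: mR RB; apply: leq_maxl.
by exists k; apply/(RP (k :: s)); [rewrite /= hs | exists B].
Qed.

(** Each of the finitely many [k] has its own stage; their maximum, built by induction on the bound,
    works for all of them. *)
Lemma semi_ball d (P : nat -> seq nat -> Prop) b :
  semi d.+1 (fun s => P (nth 0 s 0) (behead s)) -> recf d b ->
  semi d (fun s => forall k, k < b s -> P k s).
Proof.
move=> [R [dR mR RP]] hb.
exists (fun B s => forall k, k < b s -> R B (k :: s)); split.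
- apply: (dec_ball (P := fun k s => R (nth 0 s 0) (k :: behead s)));
    last exact: recf_sub hb (vecf_behead _).
  exact: dec_sub dR (vecf_swap d).
- by move=> s B B' BB' RB k /RB; apply: mR.
move=> s hs.
have RPk k : P k s <-> exists B, R B (k :: s).
  by apply: (RP (k :: s)); rewrite /= hs.
split=> [Pb|[B RB] k kb]; last by apply/RPk; exists B; apply: RB.
elim: (b s) Pb => [|c IH] Pb; first by exists 0.
have [k kc|B RB] := IH; first exact/Pb/ltnW.
have /RPk[C RC] := Pb c (ltnSn c).
exists (maxn B C) => k; rewrite ltnS leq_eqVlt => /orP[/eqP->|/RB].
  by apply: mR RC; apply: leq_maxr.
by apply: mR; apply: leq_maxl.
Qed.

Lemma semi_or d P Q : semi d P -> semi d Q -> semi d (fun s => P s \/ Q s).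
Proof.
move=> [R [dR mR RP]] [S [dS mS SQ]]; exists (fun B s => R B s \/ S B s); split.
- apply: dec_ext (dec_not (dec_and (dec_not dR) (dec_not dS))) => s _.
  by rewrite -not_orE notK.
- by move=> s B B' BB' [/(mR _ _ _ BB')|/(mS _ _ _ BB')]; [left|right].
move=> s hs; rewrite RP // SQ //; split=> [[[B RB]|[C SC]]|[B [RB|SB]]].
- by exists B; left.
- by exists C; right.
- by left; exists B.
- by right; exists B.
Qed.

Lemma size_takeS n d s : size s = n.+1 + d ->
  [/\ size (behead s) = n + d,
      take n.+1 s = nth 0 s 0 :: take n (behead s) &
      drop n.+1 s = drop n (behead s)].
Proof. by case: s => [|k s] //= [->]. Qed.

(** The first [n] entries are the quantified vector and the remaining [d] the parameters; the
    quantifiers are removed one entry at a time. *)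
Lemma semi_exv n d (P : seq nat -> seq nat -> Prop) :
  semi (n + d) (fun s => P (take n s) (drop n s)) ->
  semi d (fun s => exists2 y, size y = n & P y s).
Proof.
elim: n P => [|n IH] P hP.
  apply: semi_ext hP => s _; rewrite take0 drop0; split; first by exists [::].
  by case=> y /size0nil->.
have h : semi d (fun s => exists2 y, size y = n & exists k, P (k :: y) s).
  apply: IH; apply: (semi_ex (P := fun k s => P (k :: take n s) (drop n s))).
  by apply: semi_ext hP => s /size_takeS[_ -> ->].
apply: semi_ext h => s _; split=> [[y <- [k Pky]]|[[//|k y] [sy] Pky]].
  by exists (k :: y).
by exists y => //; exists k.
Qed.

Lemma semi_ballv n d (P : seq nat -> seq nat -> Prop) b :
  semi (n + d) (fun s => P (take n s) (drop n s)) -> recf d b ->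
  semi d (fun s => forall y, size y = n -> all (ltn^~ (b s)) y -> P y s).
Proof.
move=> + hb; elim: n P => [|n IH] P hP.
  apply: semi_ext hP => s _; rewrite take0 drop0; split; last by apply.
  by move=> Ps y /size0nil->.
have h : semi d (fun s => forall y, size y = n -> all (ltn^~ (b s)) y ->
                          forall k, k < b s -> P (k :: y) s).
  apply: IH; apply: (semi_ball (P := fun k s => P (k :: take n s) (drop n s))).
    by apply: semi_ext hP => s /size_takeS[_ -> ->].
  exact: recf_sub hb (vecf_drop _ _).
apply: semi_ext h => s _; split=> [h [//|k y] [sy] /= /andP[kb yb]|h y sy yb k kb].
  exact: h.
by apply: h; rewrite /= ?sy ?kb.
Qed.

(** Two searches: first for a stage [C s] that accepts some value not exceeding it, then for a value
    accepted at that stage. A value accepted at any stage is [F s], so the second search returns the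
    right one. *)
Lemma recf_semi_graph d F :
  semi d.+1 (fun s => nth 0 s 0 = F (behead s)) -> recf d F.
Proof.
move=> [R [dR mR RF]].
have RFs s y : size s = d -> y = F s <-> exists B, R B (y :: s).
  by move=> hs; apply: (RF (y :: s)); rewrite /= hs.
have [|s hs|C hC RC] := @recf_mu d (fun B s => exists2 y, y < B.+1 & R B (y :: s)).
- apply: (dec_bex (P := fun k s => R (nth 0 s 0) (k :: behead s)));
    last exact: recf_succ (recf_nth _ 0).
  exact: dec_sub dR (vecf_swap d).
- have [B RB] := (RFs s (F s) hs).1 erefl.
  exists (maxn B (F s)), (F s); first by rewrite ltnS leq_maxr.
  by apply: mR RB; apply: leq_maxl.
have [|s hs|G hG RG] := @recf_mu d (fun y s => R (C s) (y :: s)).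
- apply: (dec_sub dR (X := fun s => C (behead s) :: nth 0 s 0 :: behead s)).
  apply: vecf_cons; first exact: recf_sub hC (vecf_behead _).
  exact: vecf_cons (recf_nth _ 0) (vecf_behead _).
- by have [y _ Ry] := RC s hs; exists y.
by apply: recf_ext hG => s hs; apply/RFs => //; exists (C s); apply: RG.
Qed.

(** * Codes of tuples and graphs of universal functions *)

Lemma pairing_inj (pr : 2.-tuple nat -> nat) : pairing pr ->
  forall a b c d, pr [tuple a; b] = pr [tuple c; d] -> a = c /\ b = d.
Proof. by move=> [_ /bij_inj pr_inj _] a b c d /pr_inj[-> ->]. Qed.

Lemma code_cons pr x s : s != [::] -> code pr (x :: s) = pr [tuple x; code pr s].
Proof. by case: s. Qed.

(** The lengths have to agree, because every number is also the code of a sequence of length one. *)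
Lemma code_inj pr s t : pairing pr -> size s = size t ->
  code pr s = code pr t -> s = t.
Proof.
move=> hpr; elim: s t => [|x s IH] [|y t] // [st].
have [s0|s0] := eqVneq s [::].
  by move: st; rewrite s0 => /esym/size0nil-> /= ->.
rewrite !code_cons //; last by rewrite -size_eq0 -st size_eq0.
by move=> /(pairing_inj hpr)[-> /(IH _ st)->].
Qed.

Lemma recf_code pr d n X : pairing pr -> vecf d n X ->
  recf d (fun s => code pr (X s)).
Proof.
move=> [hpr _ _]; elim: n X => [|n IH] X [sX hX].
  by apply: recf_ext (recf_const d 0) => s /sX/size0nil->.
case: n IH sX => [_|n IH] sX.
  apply: recf_ext (hX 0) => s /sX.
  by case: (X s) => [|x []].
have hb : vecf d n.+1 (fun s => behead (X s)).
  split=> [s /sX|i]; first by rewrite size_behead => ->.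
  by apply: recf_ext (hX i.+1) => s _; rewrite nth_behead.
apply: recf_ext (recf_app2 hpr (hX 0) (IH _ hb)) => s /sX.
by case: (X s) => [|x [|y t]].
Qed.

Lemma semi_ce A d F : ce A -> recf d F -> semi d (fun s => A (F s)).
Proof.
move=> [->|[f hf ->]] hF.
  apply: semi_ext (semi_dec (dec_neq0 (recf_const d 0))) => s _.
  by split=> // h; apply: h.
have h : semi d (fun s => exists k, f [tuple k] = F s).
  apply/semi_ex/semi_dec/dec_eq; first exact: recf_app1 hf (recf_nth _ _).
  exact: recf_sub hF (vecf_behead _).
apply: semi_ext h => s _; split=> [[k <-]|[x _ <-]]; first by exists [tuple k].
by exists (tnth x ord0); congr f; apply/val_inj; case: x => -[|y []].
Qed.

(* Meant for an [f] that enumerates the extended graph of the universal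
   function of a numbering [theta]: then it says [theta j x = Some v]. *)
Definition graph_by (pr : 2.-tuple nat -> nat) (f : 1.-tuple nat -> nat)
    j x v : Prop :=
  exists k, f [tuple k] = pr [tuple code pr (j :: x); v.+1].

Lemma semi_graph_by pr f d n J X V : pairing pr -> computable f ->
  recf d J -> vecf d n X -> recf d V ->
  semi d (fun s => graph_by pr f (J s) (X s) (V s)).
Proof.
move=> hpr hf hJ hX hV; apply/semi_ex/semi_dec/dec_eq.
  exact: recf_app1 hf (recf_nth _ _).
have h : recf d (fun s => pr [tuple code pr (J s :: X s); (V s).+1]).
  apply: recf_app2; [by case: hpr | | exact: recf_succ].
  exact: recf_code hpr (vecf_cons hJ hX).
exact: recf_sub h (vecf_behead _).
Qed.

(** The second component [v.+1] rules out the points of the extended graph that end in 0, and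
    injectivity of the coding recovers index and argument from the remaining ones. *)
Lemma graph_byE pr n (theta : nat -> pfun n) f : pairing pr ->
  range f = extgraph pr (universal theta) ->
  forall j (x : n.-tuple nat) v, graph_by pr f j x v <-> theta j x = Some v.
Proof.
move=> hpr hf j x v; split=> [[k fk]|thx].
  have [[y _ /(pairing_inj hpr)[]//]|[y [w [thy]]]] :
      extgraph pr (universal theta) (pr [tuple code pr (j :: x); v.+1]).
    by rewrite -hf -fk; exists [tuple k].
  move=> /(pairing_inj hpr)[/(code_inj hpr) jx [->]].
  move: thy; rewrite /universal.
  have -> : y = [tuple of j :: x] by apply/val_inj; rewrite /= -jx // !size_tuple.
  by rewrite theadE => <-; congr theta; apply: val_inj.
have : extgraph pr (universal theta) (pr [tuple code pr (j :: x); v.+1]).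
  right; exists [tuple of j :: x], v; split=> //.
  by rewrite /universal theadE -thx; congr theta; apply: val_inj.
rewrite -hf => -[k _ fk]; exists (tnth k ord0); rewrite -fk; congr f.
by apply/val_inj; case: k {fk} => -[|y []].
Qed.

Definition subst_graph pr (f g : 1.-tuple nat -> nat) m js j x v : Prop :=
  exists2 z, size z = m &
    (forall nu : 'I_m, graph_by pr f (nth 0 js nu) x (nth 0 z nu)) /\
    graph_by pr g j z v.

Lemma semi_subst_graph pr f g m n d JS J X V :
  pairing pr -> computable f -> computable g ->
  vecf d m JS -> recf d J -> vecf d n X -> recf d V ->
  semi d (fun s => subst_graph pr f g m (JS s) (J s) (X s) (V s)).
Proof.
move=> hpr hf hg hJS hJ hX hV; have hD := vecf_drop m d.
apply: (semi_exv (P := fun z s =>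
  (forall nu : 'I_m, graph_by pr f (nth 0 (JS s) nu) (X s) (nth 0 z nu)) /\
  graph_by pr g (J s) z (V s))).
apply: semi_and.
  apply: semi_forall => nu.
  apply: (semi_graph_by (J := fun s => nth 0 (JS (drop m s)) nu)
    (X := fun s => X (drop m s)) (V := fun s => nth 0 (take m s) nu)) => //.
  - exact: (vecf_sub hJS hD).2.
  - exact: (vecf_sub hX hD).
  - exact: (vecf_take _ _).2.
apply: (semi_graph_by (J := fun s => J (drop m s))
  (X := take m) (V := fun s => V (drop m s))) => //.
- exact: (recf_sub hJ hD).
- exact: vecf_take.
- exact: (recf_sub hV hD).
Qed.

Lemma subst_graphE pr m n (thm : nat -> pfun m) (thn : nat -> pfun n) f g :
  pairing pr -> range f = extgraph pr (universal thn) ->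
  range g = extgraph pr (universal thm) ->
  forall (js : m.-tuple nat) j (x : n.-tuple nat) v,
    subst_graph pr f g m js j x v <->
    Subst (thm j) (fun nu => thn (tnth js nu)) x = Some v.
Proof.
move=> hpr hf hg js j x v; rewrite /Subst; split=> [[z /eqP sz [hz zv]]|].
  (* The intermediate vector [z] is forced to consist of the values of the inner functions. *)
  have {}hz (nu : 'I_m) : thn (tnth js nu) x = Some (tnth (Tuple sz) nu).
    by rewrite !(tnth_nth 0); apply/(graph_byE hpr hf).
  case: ifPn => [_|/forallPn[nu]]; last by rewrite hz.
  rewrite -/(tval (Tuple sz)) in zv; move/(graph_byE hpr hg): zv => <-.
  by congr thm; apply: eq_from_tnth => nu; rewrite tnth_mktuple hz.
case: forallP => // hx hv.
exists [tuple odflt 0 (thn (tnth js nu) x) | nu < m]; first by rewrite size_tuple.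
split=> [nu|]; last by apply/(graph_byE hpr hg).
rewrite -!tnth_nth tnth_mktuple; apply/(graph_byE hpr hf).
by case: (thn _ x) (hx nu).
Qed.

(** The second conjunct expresses the domain condition of [Mhat] through graphs alone: some box with
    side in [A] contains [x], and the composition has a value at each of its points. *)
Definition msubst_graph A pr f g m n js j x v : Prop :=
  subst_graph pr f g m js j x v /\
  exists a, [/\ A a, all (ltn^~ a) x &
    forall y, size y = n -> all (ltn^~ a) y ->
      exists w, subst_graph pr f g m js j y w].

Lemma semi_all d n X b : vecf d n X -> recf d b ->
  semi d (fun s => all (ltn^~ (b s)) (X s)).
Proof.
move=> [sX hX] hb.
have h : semi d (fun s => forall i : 'I_n, nth 0 (X s) i < b s).
  by apply: semi_forall => i; apply: semi_dec; apply: dec_lt.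
apply: semi_ext h => s /sX hs; split=> [h|/all_nthP h i].
  by apply/(all_nthP 0) => i; rewrite hs => lti; apply: h (Ordinal lti).
by apply: h; rewrite hs.
Qed.

Lemma semi_msubst_graph A pr f g m n d JS J X V :
  ce A -> pairing pr -> computable f -> computable g ->
  vecf d m JS -> recf d J -> vecf d n X -> recf d V ->
  semi d (fun s => msubst_graph A pr f g m n (JS s) (J s) (X s) (V s)).
Proof.
move=> hA hpr hf hg hJS hJ hX hV; apply: semi_and.
  exact: (semi_subst_graph (n := n)).
have hB := vecf_behead d.
have h : semi d (fun s => exists a, A a /\ (all (ltn^~ a) (X s) /\
    forall y, size y = n -> all (ltn^~ a) y ->
      exists w, subst_graph pr f g m (JS s) (J s) y w)).
  apply/semi_ex/semi_and; first exact: semi_ce hA (recf_nth _ _).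
  apply: semi_and; first exact: semi_all (vecf_sub hX hB) (recf_nth _ _).
  apply: (semi_ballv (P := fun y s => exists w,
    subst_graph pr f g m (JS (behead s)) (J (behead s)) y w)); last exact: recf_nth.
  apply: (semi_ex (P := fun w s => subst_graph pr f g m (JS (behead (drop n s)))
    (J (behead (drop n s))) (take n s) w)).
  (* The sequence now consists of [w], the [n] entries of [y], then [a] and the [d] parameters; this
     map recovers the parameters. *)
  have hBD : vecf (n + d.+1).+1 d (fun s => behead (drop n (behead s))).
    apply: vecf_sub hB _; exact: vecf_sub (vecf_drop _ _) (vecf_behead _).
  apply: (semi_subst_graph (JS := fun s => JS (behead (drop n (behead s))))
    (J := fun s => J (behead (drop n (behead s))))
    (X := fun s => take n (behead s)) (V := fun s => nth 0 s 0)) => //.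
  - exact: (vecf_sub hJS hBD).
  - exact: (recf_sub hJ hBD).
  - exact: vecf_sub (vecf_take _ _) (vecf_behead _).
  - exact: recf_nth.
by apply: semi_ext h => s _; split=> -[a [? []]]; exists a.
Qed.

Lemma boxP n a (x : n.-tuple nat) : box n a x <-> all (ltn^~ a) x.
Proof.
by split=> [xa|/all_tnthP//]; apply/all_tnthP.
Qed.

Lemma msubst_graphE A pr m n (thm : nat -> pfun m) (thn : nat -> pfun n) f g :
  pairing pr -> range f = extgraph pr (universal thn) ->
  range g = extgraph pr (universal thm) ->
  forall (js : m.-tuple nat) j (x : n.-tuple nat) v,
    msubst_graph A pr f g m n js j x v <->
    MSubst A (thm j) (fun nu => thn (tnth js nu)) x = Some v.
Proof.
move=> hpr hf hg js j x v; rewrite /MSubst /Mhat /msubst_graph.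
rewrite (subst_graphE hpr hf hg).
set q := Subst _ _.
have goodE a : (box n a `<=` dom q)%classic <->
    forall y, size y = n -> all (ltn^~ a) y -> exists w, subst_graph pr f g m js j y w.
  split=> [aq y /eqP sy ya|aq y /boxP ya].
    have /aq : box n a (Tuple sy) by apply/boxP.
    rewrite /dom /=; case E: (q _) => [w|//] _; exists w.
    by apply/(subst_graphE hpr hf hg _ _ (Tuple sy)).
  have [//|w /(subst_graphE hpr hf hg)] := aq y _ ya; first by rewrite size_tuple.
  by rewrite /dom /q /= => ->.
split=> [[qx [a [Aa xa qa]]]|].
  by rewrite asboolT //; exists a; split=> //; [apply/boxP | apply/goodE].
case: asboolP => // -[a [Aa /boxP xa /goodE qa]] qx; split=> //.
by exists a.
Qed.

(** * Modified substitution stays in the class [SA] *)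

Lemma SA_Mhat A n (q : pfun n) :
  ((forall x, Mhat A q x) -> exists2 f, computable f & Mhat A q = Defs.total f) ->
  SA A n (Mhat A q).
Proof.
move=> hq; pose good a := `[< A a /\ (box n a `<=` dom q)%classic >].
(* The domain is the union of the boxes with side in [A] that lie inside the domain of [q]. *)
have domE x : Mhat A q x <-> exists2 a, good a & box n a x.
  rewrite /Mhat; case: asboolP => [[a [Aa xa aq]]|h].
    split=> _; last exact: aq.
    by exists a => //; apply/asboolP.
  split=> // -[a /asboolP[Aa aq] xa]; by case: h; exists a.
have [/hq[f hf ->]|] := pselect (forall x, Mhat A q x).
  by left; exists f.
move=> /existsNP[x0 x0q]; right.
have [[a0 ga0]|nogood] := pselect (exists a, good a); last first.
  left; rewrite -subset0 => x /domE[a ga]; case: nogood; by exists a.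
(* A point [x0] outside the domain lies in no good box, so no good side exceeds the largest
   coordinate of [x0]. *)
have ub a : good a -> a <= \max_(i < n) tnth x0 i.
  rewrite leqNgt => ga; apply/negP => lta; apply: x0q; apply/domE.
  by exists a => // i; apply: leq_ltn_trans lta; apply: leq_bigmax.
have exg : exists a, good a by exists a0.
case: (ex_maxnP exg ub) => a ga amax; right; exists a.
  by have /asboolP[] := ga.
(* Boxes are nested, so the one with the largest good side is the whole union. *)
apply/seteqP; split=> x; last by move=> xa; apply/domE; exists a.
by move=> /domE[b /amax ba xb] i; apply: leq_trans ba.
Qed.

(** * Uniform enumeration of the extended graphs and application of QGN II *)

Theorem theorem4p7
  (pr : 2.-tuple nat -> nat) (hpr : pairing pr)
  (A : set nat) (hinf : infinite_set A) (hce : ce A)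
  (theta : forall n : nat, nat -> pfun n)
  (htheta : forall n : nat, 1 <= n -> quasi_godel pr A (theta n))
  (m n : nat) (hm : 1 <= m) (hn : 1 <= n) :
  exists2 sub : m.+1.-tuple nat -> nat, computable sub &
    forall (j : nat) (js : m.-tuple nat),
      theta n (sub [tuple of j :: js])
      = MSubst A (theta m j) (fun nu : 'I_m => theta n (tnth js nu)).
Proof.
have [_ [g hg gE] _] := htheta m hm.
have [_ [f hf fE] qgn2] := htheta n hn.
pose M := msubst_graph A pr f g m n.
have ME (js : m.-tuple nat) j (x : n.-tuple nat) v : M js j x v <->
    MSubst A (theta m j) (fun nu => theta n (tnth js nu)) x = Some v.
  exact: msubst_graphE hpr fE gE js j x v.
have MSA j (js : m.-tuple nat) :
    SA A n (MSubst A (theta m j) (fun nu => theta n (tnth js nu))).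
  apply: SA_Mhat => tot; set r := Mhat _ _ in tot *.
  (* [F] extends [r] to sequences of any length, with value 0 when the length is not [n]. *)
  pose F s := odflt 0 (if insub s is Some x then r x else None).
  have FE (x : n.-tuple nat) : r x = Some (F x).
    by rewrite /F valK; case: (r x) (tot x).
  exists (fun x => F x); last by apply/funext.
  apply: recf_semi_graph.
  have h : semi n.+1 (fun s => M js j (behead s) (nth 0 s 0)).
    apply: semi_msubst_graph => //.
    - by have := vecf_const n.+1 js; rewrite size_tuple.
    - exact: recf_const.
    - exact: vecf_behead.
    - exact: recf_nth.
  apply: semi_ext h => s hs.
  have sb : size (behead s) == n by rewrite size_behead hs.
  rewrite -[behead s]/(tval (Tuple sb)) ME -[MSubst _ _ _ _]/(r _) FE.
  by split=> [[->]|->].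
(* [W i z] places [z] in the extended graph belonging to the indices coded by [i]. The points ending
   in 0 are common to all extended graphs, so the first disjunct does not mention [i]. *)
pose W i z := (exists2 y, size y = n & z = pr [tuple code pr y; 0]) \/
  (exists2 js, size js = m & exists2 x, size x = n & exists j v,
    [/\ i = code pr (j :: js), z = pr [tuple code pr x; v.+1] & M js j x v]).
have WE j (js : m.-tuple nat) z : W (code pr (j :: js)) z <->
    extgraph pr (MSubst A (theta m j) (fun nu => theta n (tnth js nu))) z.
  split=> [[[y /eqP sy ->]|]|[[y _ <-]|[x [v [/ME Mv ->]]]]].
  - by left; exists (Tuple sy).
  - move=> [js' sjs [x /eqP sx [j' [v [/(code_inj hpr)]]]]].
    rewrite /= sjs size_tuple => /(_ erefl)[<- <-] -> Mv; right.
    by exists (Tuple sx), v; split=> //; apply/ME.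
  - by left; exists y; rewrite ?size_tuple.
  - right; exists js; rewrite ?size_tuple //; exists x; rewrite ?size_tuple //.
    by exists j, v.
have prC : computable pr by case: hpr.
have semiW : semi 2 (fun s => W (nth 0 s 0) (nth 0 s 1)).
  apply: semi_or.
    apply: (semi_exv (P := fun y s => nth 0 s 1 = pr [tuple code pr y; 0])).
    apply/semi_dec/dec_eq; first exact: (vecf_drop _ _).2.
    by apply: recf_app2 (recf_const _ _) => //; apply: recf_code (vecf_take _ _).
  apply: (semi_exv (P := fun js s => exists2 x, size x = n & exists j v,
    [/\ nth 0 s 0 = code pr (j :: js),
        nth 0 s 1 = pr [tuple code pr x; v.+1] & M js j x v])).
  apply: (semi_exv (P := fun x s => exists j v,
    [/\ nth 0 (drop m s) 0 = code pr (j :: take m s),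
        nth 0 (drop m s) 1 = pr [tuple code pr x; v.+1] & M (take m s) j x v])).
  apply: (semi_ex (P := fun j s => exists v,
    [/\ nth 0 (drop m (drop n s)) 0 = code pr (j :: take m (drop n s)),
        nth 0 (drop m (drop n s)) 1 = pr [tuple code pr (take n s); v.+1] &
        M (take m (drop n s)) j (take n s) v])).
  apply: (semi_ex (P := fun v s => let xs := behead s in let js := drop n xs in
    [/\ nth 0 (drop m js) 0 = code pr (nth 0 s 0 :: take m js),
        nth 0 (drop m js) 1 = pr [tuple code pr (take n xs); v.+1] &
        M (take m js) (nth 0 s 0) (take n xs) v])).
  (* With all quantifiers removed, the sequence lists [v], [j], the [n] entries of [x], the [m]
     entries of [js], and finally [i] and [z]. *)
  have hxs : vecf (n + (m + 2)).+2 (n + (m + 2)) (fun s => behead (behead s)).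
    exact: vecf_sub (vecf_behead _) (vecf_behead _).
  have hjs := vecf_sub (vecf_drop _ _) hxs.
  have hx := vecf_sub (vecf_take _ _) hxs.
  have hj : recf (n + (m + 2)).+2 (fun s => nth 0 (behead s) 0).
    exact: (vecf_behead _).2.
  have hc := recf_code hpr (vecf_cons hj (vecf_sub (vecf_take _ _) hjs)).
  have h1 := dec_eq ((vecf_sub (vecf_drop _ _) hjs).2 0) hc.
  have h2 := dec_eq ((vecf_sub (vecf_drop _ _) hjs).2 1)
    (recf_app2 prC (recf_code hpr hx) (recf_succ (recf_nth _ 0))).
  have h3 := semi_msubst_graph hce hpr hf hg
    (vecf_sub (vecf_take _ _) hjs) hj hx (recf_nth _ 0).
  by apply: semi_ext (semi_and (semi_dec h1) (semi_and (semi_dec h2) h3)) => s _;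
    split=> [[? []]|[]].
have [R [decR _ RW]] := semiW.
(* The two projections of the pairing are computable because their graphs are semidecidable: one
   searches for the other component. *)
have [l [hl [r [hr lr]]]] : exists l, recf 1 l /\ exists r, recf 1 r /\
    forall a b, l [:: pr [tuple a; b]] = a /\ r [:: pr [tuple a; b]] = b.
  have [_ [inv prK invK] _] := hpr.
  exists (fun s => thead (inv (nth 0 s 0))); split.
    apply: recf_semi_graph.
    have h : semi 2 (fun s => exists b, pr [tuple nth 0 s 0; b] = nth 0 s 1).
      apply/semi_ex/semi_dec/dec_eq; last exact: (vecf_behead _).2.
      by apply: recf_app2 (recf_nth _ 0) => //; apply: (vecf_behead _).2.
    apply: semi_ext h => s _; rewrite nth_behead; split=> [[b <-]|->].
      by rewrite prK.
    exists (tnth (inv (nth 0 s 1)) ord_max); rewrite -[RHS]invK; congr pr.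
    by case/tupleP: (inv _) => a /tupleP[b t]; rewrite tuple0; apply: val_inj.
  exists (fun s => tnth (inv (nth 0 s 0)) ord_max); split.
    apply: recf_semi_graph.
    have h : semi 2 (fun s => exists a, pr [tuple a; nth 0 s 0] = nth 0 s 1).
      apply/semi_ex/semi_dec/dec_eq; last exact: (vecf_behead _).2.
      by apply: recf_app2 (recf_nth _ 0) _ => //; apply: (vecf_behead _).2.
    apply: semi_ext h => s _; rewrite nth_behead; split=> [[a <-]|->].
      by rewrite prK.
    exists (thead (inv (nth 0 s 1))); rewrite -[RHS]invK; congr pr.
    by case/tupleP: (inv _) => a /tupleP[b t]; rewrite tuple0; apply: val_inj.
  by move=> a b; rewrite /= prK.
(* A point common to all the extended graphs, output whenever the test in [K] fails, so that [K] is
   total and adds nothing wrong. *)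
pose c0 := pr [tuple code pr (nseq n 0); 0].
(* On input [i] and [t], decode [t] as a pair of a candidate and a stage, and output the candidate
   if it is accepted for [i] at that stage. For fixed [i] the range is then the set of [z] with
   [W i z], provided [c0] belongs to it. *)
pose K s := let a := l [:: nth 0 s 1] in
  if `[< R (r [:: nth 0 s 1]) [:: nth 0 s 0; a] >] then a else c0.
have hK : recf 2 K.
  have h1 := vecf_cons (recf_nth 2 1) (vecf_nil 2).
  have hl1 := recf_sub hl h1; have hr1 := recf_sub hr h1.
  apply: (recf_if _ hl1 (recf_const _ c0)).
  exact: dec_sub decR (vecf_cons hr1 (vecf_cons (recf_nth _ 0)
    (vecf_cons hl1 (vecf_nil _)))).
have [v hv vE] := qgn2 (fun x => K x) hK.
(* QGN II handles a single index, so [sub] first codes all its arguments into one number. *)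
exists (fun x => v [tuple code pr x]).
  by apply: (recf_app1 hv); apply: recf_code hpr (vecf_id _).
move=> j js; apply/esym/vE => //.
apply/seteqP; split=> z.
  move=> [t _ <-]; apply/WE; rewrite /K /=.
  case: asboolP => [Rt|_]; last by left; exists (nseq n 0); rewrite ?size_nseq.
  by apply/(RW [:: _; _]) => //; exists (r [:: t]).
move=> /WE /(RW [:: _; _])[//|B RB]; exists (pr [tuple z; B]) => //.
rewrite /K /=; have [-> ->] := lr z B.
by rewrite asboolT.
Qed.
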